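(* Let $(\theta_x,\theta_t)\in\Theta_{L_x,L_t}^{\mathrm{low},\mathrm{f}}$. With the assumption of periodic boundary conditions in space and time, the two-grid operator with semi-coarsening in time $$\mathcal M^{\mathrm s}_{\tau_L,h_L}:=\mathcal S_{\tau_L,h_L}^{\nu_2}\Big[I-\mathcal P_{\mathrm s}^{L_x,L_t}\big(\mathcal L_{2\tau_L,h_L}\big)^{-1}\mathcal R_{\mathrm s}^{L_x,L_t}\mathcal L_{\tau_L,h_L}\Big]\mathcal S_{\tau_L,h_L}^{\nu_1}$$ satisfies the mapping property $$\mathcal M^{\mathrm s}_{\tau_L,h_L}:\mathcal E_{L_x,L_t}(\theta_x,\theta_t)\to\mathcal E_{L_x,L_t}(\theta_x,\theta_t),$$ with the mapping of coefficient matrices $$\begin{pmatrix} U_1 \\ U_2 \\ U_3 \\ U_4 \end{pmatrix}\mapsto\widetilde{\mathcal M}^{\mathrm s}_\mu(\theta_x,\theta_t)\begin{pmatrix} U_1 \\ U_2 \\ U_3 \\ U_4 \end{pmatrix}$$ and the iteration matrix $$\widetilde{\mathcal M}^{\mathrm s}_\mu(\theta_x,\theta_t):=\big(\widetilde{\mathcal S}_{\tau_L,h_L}(\theta_x,\theta_t)\big)^{\nu_2}\,\widetilde{\mathcal K}_{\mathrm s}(\theta_x,\theta_t)\,\big(\widetilde{\mathcal S}_{\tau_L,h_L}(\theta_x,\theta_t)\big)^{\nu_1}\in\mathbb{C}^{4N_t\times4N_t},$$ where $$\widetilde{\mathcal K}_{\mathrm s}(\theta_x,\theta_t):=I_{4N_t}-\widetilde{\mathcal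 P}_{\mathrm s}(\theta_t)\big(\widetilde{\mathcal L}^{\mathrm s}_{2\tau_L,h_L}(\theta_x,2\theta_t)\big)^{-1}\widetilde{\mathcal R}_{\mathrm s}(\theta_t)\,\widetilde{\mathcal L}_{\tau_L,h_L}(\theta_x,\theta_t).$$
   Context: **Discretization.** The problem is the one-dimensional heat equation on $(0,1)\times(0,T)$, discretized by piecewise linear finite elements of mesh size $h_L$ in space and a discontinuous Galerkin method of degree $p_t\in\mathbb{N}_0$ with step $\tau_L$ in time; $N_t=p_t+1$, $\mu=\tau_Lh_L^{-2}$. $N_{L_x}$ (spatial unknowns) and $N_{L_t}$ (time steps) are even; $N_{L_t-1}=N_{L_t}/2$. $\nu_1,\nu_2\in\mathbb{N}$ are the numbers of pre- and post-smoothing steps and $\omega_t$ is the damping parameter of the smoother. For $\tau>0$ and a basis $\{\psi_k\}_{k=1}^{N_t}$ of the polynomials of degree $\le p_t$ on $(0,\tau)$: $K_\tau[k,\ell]=-\int_0^\tau\psi_\ell\psi_k'\,dt+\psi_\ell(\tau)\psi_k(\tau)$, $M_\tau[k,\ell]=\int_0^\tau\psi_\ell\psi_k\,dt$, $N_\tau[k,\ell]=\psi_\ell(\tau)\psi_k(0)$. Matrices with index $\tau_L$ use a basis $\{\psi_k\}$ on $(0,\tau_L)$, those with index $2\tau_L$ a basis $\{\widetilde\psi_k\}$ on $(0,2\tau_L)$. Vectors are $u=(u_{n,r})$ with $u_{n,r}\in\mathbb{C}^{N_t}$, $n$ the time-step index and $r=1,\dots,N_{L_x}$ the spatial index. Periodic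 boundary conditions in space-time, $u(t,0)=u(t,1)$ for $t\in(0,T)$ and $u(0,x)=u(T,x)$ for $x\in(0,1)$, mean that both indices are read cyclically. Set $(M_hu)_{n,r}=\frac h6(u_{n,r-1}+4u_{n,r}+u_{n,r+1})$, $(K_hu)_{n,r}=\frac1h(-u_{n,r-1}+2u_{n,r}-u_{n,r+1})$. The system operator is $(\mathcal L_{\tau,h}u)_{n,r}=K_\tau(M_hu)_{n,r}+M_\tau(K_hu)_{n,r}-N_\tau(M_hu)_{n-1,r}$, acting on $N_{L_t}$ time steps for $\tau=\tau_L$ and on $N_{L_t-1}$ time steps for $\tau=2\tau_L$. Its block diagonal part is $(D_{\tau,h}u)_{n,r}=K_\tau(M_hu)_{n,r}+M_\tau(K_hu)_{n,r}$, and the damped block Jacobi smoother with $\nu$ steps is $\mathcal S^\nu_{\tau_L,h_L}=[I-\omega_tD_{\tau_L,h_L}^{-1}\mathcal L_{\tau_L,h_L}]^\nu$. **Transfer operators.** $R_1^\top=M_{\tau_L}^{-1}\widetilde M^1$, $R_2^\top=M_{\tau_L}^{-1}\widetilde M^2$ with $\widetilde M^1[k,\ell]=\int_0^{\tau_L}\widetilde\psi_\ell(t)\psi_k(t)\,dt$, $\widetilde M^2[k,\ell]=\int_{\tau_L}^{2\tau_L}\widetilde\psi_\ell(t)\psi_k(t-\tau_L)\,dt$. For $n=1,\dots,N_{L_t-1}$: $(\mathcal R_{\mathrm s}^{L_x,L_t}u)_{n,r}=R_1u_{2n-1,r}+R_2u_{2n,r}$ (identity in space, restriction in time), and $\mathcal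 P_{\mathrm s}^{L_x,L_t}=(\mathcal R_{\mathrm s}^{L_x,L_t})^\top$. **Frequencies and Fourier spaces.** $\Theta_{L_x,L_t}=\{(\frac{2k\pi}{N_{L_x}},\frac{2\ell\pi}{N_{L_t}}):k=1-\frac{N_{L_x}}2,\dots,\frac{N_{L_x}}2,\ \ell=1-\frac{N_{L_t}}2,\dots,\frac{N_{L_t}}2\}$, $\Theta_{L_x,L_t}^{\mathrm{low},\mathrm f}=\Theta_{L_x,L_t}\cap(-\frac\pi2,\frac\pi2]^2$, $\gamma(\theta)=\theta-\mathrm{sign}(\theta)\pi$ with $\mathrm{sign}(0)=-1$. $\Phi(\theta_x,\theta_t)$ is the vector with $\Phi_{n,r}(\theta_x,\theta_t)=e^{\mathrm i n\theta_t}e^{\mathrm i r\theta_x}(1,\dots,1)^\top\in\mathbb{C}^{N_t}$ (on $N_{L_t}$ or $N_{L_t-1}$ time steps). $\mathcal E_{L_x,L_t}(\theta_x,\theta_t)$ (space of harmonics) is the set of vectors $\psi$ on $N_{L_t}$ time steps with $\psi_{n,r}=U_1\Phi_{n,r}(\theta_x,\theta_t)+U_2\Phi_{n,r}(\gamma(\theta_x),\theta_t)+U_3\Phi_{n,r}(\theta_x,\gamma(\theta_t))+U_4\Phi_{n,r}(\gamma(\theta_x),\gamma(\theta_t))$ for some $U_1,\dots,U_4\in\mathbb{C}^{N_t\times N_t}$, its coefficient matrices. $\Psi_{L_x,L_t-1}(\theta_x,2\theta_t)$ is the set of vectors on $N_{L_t-1}$ time steps with $\psi_{n,r}=U_1\Phi_{n,r}(\theta_x,2\theta_t)+U_2\Phi_{n,r}(\gamma(\theta_x),2\theta_t)$,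 $U_1,U_2\in\mathbb{C}^{N_t\times N_t}$; the coarse inverse $(\mathcal L_{2\tau_L,h_L})^{-1}$ maps this space to itself by multiplying $(U_1,U_2)^\top$ with $(\widetilde{\mathcal L}^{\mathrm s}_{2\tau_L,h_L}(\theta_x,2\theta_t))^{-1}$. **Symbols.** $\beta(\theta_x)=6\frac{1-\cos\theta_x}{2+\cos\theta_x}$; $\hat{\mathcal L}_{\tau,h}(\theta_x,\theta_t)=\frac h3(2+\cos\theta_x)[K_\tau+h^{-2}\beta(\theta_x)M_\tau-e^{-\mathrm i\theta_t}N_\tau]$; $\hat{\mathcal S}_{\tau_L,h_L}(\theta_x,\theta_t)=(1-\omega_t)I_{N_t}+\omega_te^{-\mathrm i\theta_t}(K_{\tau_L}+h_L^{-2}\beta(\theta_x)M_{\tau_L})^{-1}N_{\tau_L}$; $\hat{\mathcal R}(\theta_t)=e^{-\mathrm i\theta_t}R_1+R_2$; $\hat{\mathcal P}(\theta_t)=\frac12[e^{\mathrm i\theta_t}R_1^\top+R_2^\top]$. $\widetilde{\mathcal L}_{\tau_L,h_L}(\theta_x,\theta_t)$ and $\widetilde{\mathcal S}_{\tau_L,h_L}(\theta_x,\theta_t)$ are the block diagonal $4N_t\times4N_t$ matrices whose diagonal blocks are $\hat{\mathcal L}_{\tau_L,h_L}$, respectively $\hat{\mathcal S}_{\tau_L,h_L}$, evaluated at $(\theta_x,\theta_t),(\gamma(\theta_x),\theta_t),(\theta_x,\gamma(\theta_t)),(\gamma(\theta_x),\gamma(\theta_t))$ in this order. $$\widetilde{\mathcal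 R}_{\mathrm s}(\theta_t)=\begin{pmatrix} \hat{\mathcal R}(\theta_t) & 0 & \hat{\mathcal R}(\gamma(\theta_t)) & 0 \\ 0 & \hat{\mathcal R}(\theta_t) & 0 & \hat{\mathcal R}(\gamma(\theta_t)) \end{pmatrix},\quad \widetilde{\mathcal P}_{\mathrm s}(\theta_t)=\begin{pmatrix} \hat{\mathcal P}(\theta_t) & 0 \\ 0 & \hat{\mathcal P}(\theta_t) \\ \hat{\mathcal P}(\gamma(\theta_t)) & 0 \\ 0 & \hat{\mathcal P}(\gamma(\theta_t)) \end{pmatrix},$$ $$\big(\widetilde{\mathcal L}^{\mathrm s}_{2\tau_L,h_L}(\theta_x,2\theta_t)\big)^{-1}=\begin{pmatrix}\big(\hat{\mathcal L}_{2\tau_L,h_L}(\theta_x,2\theta_t)\big)^{-1}&0\\0&\big(\hat{\mathcal L}_{2\tau_L,h_L}(\gamma(\theta_x),2\theta_t)\big)^{-1}\end{pmatrix}.$$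
   Formalization: The coarse operator is singular under periodic conditions, so its inverse is taken to be any map inverting it on the space Ψ(θ_x,2θ_t); this leaves out only the frequency (0,0), where the inverse symbol in the formula does not exist. *)

(* Defs.v *)
From HB Require Import structures.
From mathcomp Require Import all_boot all_order all_algebra.
From mathcomp Require Import all_classical all_reals all_analysis.
From mathcomp Require Import complex qpoly.

Set Implicit Arguments.
Unset Strict Implicit.
Unset Printing Implicit Defensive.

Import Order.TTheory GRing.Theory Num.Theory.
Import numFieldNormedType.Exports.

Local Open Scope classical_set_scope.
Local Open Scope ring_scope.
Local Open Scope complex_scope.

Definition cis (R : realType) (x : R) : R[i] := cos x +i* sin x.

Definition mxC (R : realType) (m n : nat) (A : 'M[R]_(m, n)) : 'M[R[i]]_(m, n) :=
  map_mx (real_complex R) A.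

Definition Ktau (R : realType) (N : nat) (tau : R) (psi : N.-tuple {poly_N R}) :
  'M[R]_N :=
  \matrix_(k, l)
    (- (\int[lebesgue_measure]_(t in `[0, tau])
          ((tnth psi l : {poly R}).[t] * (tnth psi k : {poly R})^`().[t]))
     + (tnth psi l : {poly R}).[tau] * (tnth psi k : {poly R}).[tau]).

Definition Mtau (R : realType) (N : nat) (tau : R) (psi : N.-tuple {poly_N R}) :
  'M[R]_N :=
  \matrix_(k, l)
    \int[lebesgue_measure]_(t in `[0, tau])
      ((tnth psi l : {poly R}).[t] * (tnth psi k : {poly R}).[t]).

Definition Ntau (R : realType) (N : nat) (tau : R) (psi : N.-tuple {poly_N R}) :
  'M[R]_N :=
  \matrix_(k, l) ((tnth psi l : {poly R}).[tau] * (tnth psi k : {poly R}).[0]).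

(* [psi] is a basis on (0, tau), [psi2] a basis on (0, 2 tau). *)
Definition Mtilde1 (R : realType) (N : nat) (tau : R)
  (psi psi2 : N.-tuple {poly_N R}) : 'M[R]_N :=
  \matrix_(k, l)
    \int[lebesgue_measure]_(t in `[0, tau])
      ((tnth psi2 l : {poly R}).[t] * (tnth psi k : {poly R}).[t]).

Definition Mtilde2 (R : realType) (N : nat) (tau : R)
  (psi psi2 : N.-tuple {poly_N R}) : 'M[R]_N :=
  \matrix_(k, l)
    \int[lebesgue_measure]_(t in `[tau, 2 * tau])
      ((tnth psi2 l : {poly R}).[t] * (tnth psi k : {poly R}).[t - tau]).

Definition R1 (R : realType) (N : nat) (tau : R) (psi psi2 : N.-tuple {poly_N R}) :
  'M[R]_N := (invmx (Mtau tau psi) *m Mtilde1 tau psi psi2)^T.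

Definition R2 (R : realType) (N : nat) (tau : R) (psi psi2 : N.-tuple {poly_N R}) :
  'M[R]_N := (invmx (Mtau tau psi) *m Mtilde2 tau psi psi2)^T.

(** Space-time vectors on [nt] time steps and [nx] spatial unknowns. The 0-based
    pair (i, j) stands for the time step n = i + 1 and spatial index r = j + 1;
    [ordS] and [ord_pred] are the cyclic successor and predecessor. *)

Notation stvec R nt nx N := {ffun 'I_nt * 'I_nx -> 'cV[R[i]]_N}.

Section Operators.
Variables (R : realType) (nt nx N : nat).
Local Notation V := (stvec R nt nx N).

Definition Mh (h : R) (u : V) : V :=
  [ffun p => (h / 6)%:C *:
     (u (p.1, ord_pred p.2) + 4 *: u (p.1, p.2) + u (p.1, ordS p.2))].

Definition Kh (h : R) (u : V) : V :=
  [ffun p => (h^-1)%:C *: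
     (- u (p.1, ord_pred p.2) + 2 *: u (p.1, p.2) - u (p.1, ordS p.2))].

Definition Dop (tau h : R) (psi : N.-tuple {poly_N R}) (u : V) : V :=
  [ffun p => mxC (Ktau tau psi) *m Mh h u p + mxC (Mtau tau psi) *m Kh h u p].

Definition Lop (tau h : R) (psi : N.-tuple {poly_N R}) (u : V) : V :=
  [ffun p => mxC (Ktau tau psi) *m Mh h u p + mxC (Mtau tau psi) *m Kh h u p
             - mxC (Ntau tau psi) *m Mh h u (ord_pred p.1, p.2)].

Definition Dinv (tau h : R) (psi : N.-tuple {poly_N R}) (u : V) : V :=
  ((linfun (Dop tau h psi))^-1)%VF u.

Definition Smoother (omega tau h : R) (psi : N.-tuple {poly_N R}) (nu : nat)
  (u : V) : V :=
  iter nu (fun v : V => v - omega%:C *: Dinv tau h psi (Lop tau h psi v)) u.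

Definition Phi (thx tht : R) : V :=
  [ffun p : 'I_nt * 'I_nx => (cis (p.1.+1%:R * tht) * cis (p.2.+1%:R * thx)) *: const_mx 1].

Definition unit_vec (q : 'I_nt * 'I_nx) (k : 'I_N) : V :=
  [ffun p => if p == q then delta_mx k ord0 else 0].

End Operators.

(* Transpose (no conjugation) with respect to the canonical bases. *)
Definition transpose_op (R : realType) (nt nt' nx N : nat)
  (F : stvec R nt nx N -> stvec R nt' nx N) (w : stvec R nt' nx N) :
  stvec R nt nx N :=
  [ffun q : 'I_nt * 'I_nx => \col_k \sum_(p : 'I_nt' * 'I_nx) \sum_(j < N)
     F (unit_vec R q k) p j ord0 * w p j ord0].

Lemma odd_step_proof (nt : nat) (i : 'I_nt./2) : (i.*2 < nt)%N.
Proof. by apply: ltnW; rewrite -gtn_half_double. Qed.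

Lemma even_step_proof (nt : nat) (i : 'I_nt./2) : (i.*2.+1 < nt)%N.
Proof. by rewrite -gtn_half_double. Qed.

(* 0-based indices of the 1-based fine time steps 2n - 1 and 2n, n = i + 1 *)
Definition odd_step (nt : nat) (i : 'I_nt./2) : 'I_nt := Ordinal (odd_step_proof i).
Definition even_step (nt : nat) (i : 'I_nt./2) : 'I_nt := Ordinal (even_step_proof i).

Section TwoGrid.
Variables (R : realType) (nt nx N : nat) (tau h : R).
Variables (psi psi2 : N.-tuple {poly_N R}).

Definition Rs (u : stvec R nt nx N) : stvec R nt./2 nx N :=
  [ffun p => mxC (R1 tau psi psi2) *m u (odd_step p.1, p.2)
             + mxC (R2 tau psi psi2) *m u (even_step p.1, p.2)].

Definition Ps : stvec R nt./2 nx N -> stvec R nt nx N := transpose_op Rs.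

(* With periodic boundary conditions the coarse system operator annihilates the
   vectors constant in space and time, so it has no global inverse: [Lcinv] is a
   parameter, meant to invert it (see [inverse_on]) on the Fourier space at hand. *)
Definition two_grid (omega : R) (nu1 nu2 : nat)
  (Lcinv : stvec R nt./2 nx N -> stvec R nt./2 nx N)
  (u : stvec R nt nx N) : stvec R nt nx N :=
  let v := Smoother omega tau h psi nu1 u in
  Smoother omega tau h psi nu2 (v - Ps (Lcinv (Rs (Lop tau h psi v)))).

End TwoGrid.

Definition inverse_on (V : Type) (A : set V) (f g : V -> V) : Prop :=
  [/\ set_fun A A g, {in A, cancel g f} & {in A, cancel f g}].

Definition freqs (R : realType) (n : nat) : set R :=
  [set th | exists k : int, [/\ 1 - (n./2)%:Z <= k, k <= (n./2)%:Z
                              & th = 2 * k%:~R * pi / n%:R]].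

Definition Theta (R : realType) (nx nt : nat) : set (R * R) :=
  freqs nx `*` freqs nt.

Definition Theta_lowf (R : realType) (nx nt : nat) : set (R * R) :=
  Theta nx nt `&` (`]- (pi / 2), pi / 2] `*` `]- (pi / 2), pi / 2]).

Definition gamma_freq (R : realType) (th : R) : R :=
  th - (if 0 < th then 1 else -1) * pi.

Section Harmonics.
Variables (R : realType) (nt nx N : nat).

Definition harmonic_vec (thx tht : R) (U1 U2 U3 U4 : 'M[R[i]]_N) : stvec R nt nx N :=
  [ffun p => U1 *m Phi nt nx N thx tht p
             + U2 *m Phi nt nx N (gamma_freq thx) tht p
             + U3 *m Phi nt nx N thx (gamma_freq tht) p
             + U4 *m Phi nt nx N (gamma_freq thx) (gamma_freq tht) p].

Definition Espace (thx tht : R) : set (stvec R nt nx N) :=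
  [set v | exists U1 U2 U3 U4, v = harmonic_vec thx tht U1 U2 U3 U4].

(* To be used with [tht] twice the fine frequency and [nt] coarse time steps. *)
Definition Psispace (thx tht : R) : set (stvec R nt nx N) :=
  [set v | exists U1 U2 : 'M[R[i]]_N, v =
     [ffun p => U1 *m Phi nt nx N thx tht p
                + U2 *m Phi nt nx N (gamma_freq thx) tht p]].

End Harmonics.

Arguments Espace {R} nt nx N thx tht _.
Arguments Psispace {R} nt nx N thx tht _.

Section Symbols.
Variables (R : realType) (N : nat).
Implicit Types (psi : N.-tuple {poly_N R}) (thx tht : R).

Definition beta_sym thx : R := 6 * ((1 - cos thx) / (2 + cos thx)).

Definition Lhat (tau h : R) psi thx tht : 'M[R[i]]_N :=
  (h / 3 * (2 + cos thx))%:C *: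
    (mxC (Ktau tau psi) + (h ^- 2 * beta_sym thx)%:C *: mxC (Mtau tau psi)
     - cis (- tht) *: mxC (Ntau tau psi)).

Definition Shat (omega tau h : R) psi thx tht : 'M[R[i]]_N :=
  (1 - omega)%:C%:M
  + (omega%:C * cis (- tht)) *:
      (invmx (mxC (Ktau tau psi) + (h ^- 2 * beta_sym thx)%:C *: mxC (Mtau tau psi))
       *m mxC (Ntau tau psi)).

Definition Rhat (tau : R) psi psi2 tht : 'M[R[i]]_N :=
  cis (- tht) *: mxC (R1 tau psi psi2) + mxC (R2 tau psi psi2).

Definition Phat (tau : R) psi psi2 tht : 'M[R[i]]_N :=
  2^-1 *: (cis tht *: mxC (R1 tau psi psi2)^T + mxC (R2 tau psi psi2)^T).

Definition diag4 (f : R -> R -> 'M[R[i]]_N) thx tht :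
  'M[R[i]]_((N + N) + (N + N)) :=
  block_mx
    (block_mx (f thx tht) 0 0 (f (gamma_freq thx) tht)) 0
    0 (block_mx (f thx (gamma_freq tht)) 0 0 (f (gamma_freq thx) (gamma_freq tht))).

Definition Ltilde (tau h : R) psi := diag4 (Lhat tau h psi).

Definition Stilde (omega tau h : R) psi := diag4 (Shat omega tau h psi).

Definition Rstilde (tau : R) psi psi2 tht : 'M[R[i]]_(N + N, (N + N) + (N + N)) :=
  row_mx
    (block_mx (Rhat tau psi psi2 tht) 0 0 (Rhat tau psi psi2 tht))
    (block_mx (Rhat tau psi psi2 (gamma_freq tht)) 0 0 (Rhat tau psi psi2 (gamma_freq tht))).

Definition Pstilde (tau : R) psi psi2 tht : 'M[R[i]]_((N + N) + (N + N), N + N) :=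
  col_mx
    (block_mx (Phat tau psi psi2 tht) 0 0 (Phat tau psi psi2 tht))
    (block_mx (Phat tau psi psi2 (gamma_freq tht)) 0 0 (Phat tau psi psi2 (gamma_freq tht))).

(* To be used with the coarse step 2 tau, the coarse basis and 2 tht. *)
Definition Lstilde_inv (tau h : R) psi thx tht : 'M[R[i]]_(N + N) :=
  block_mx (invmx (Lhat tau h psi thx tht)) 0
           0 (invmx (Lhat tau h psi (gamma_freq thx) tht)).

Definition Kstilde (tau h : R) psi psi2 thx tht : 'M[R[i]]_((N + N) + (N + N)) :=
  1%:M - Pstilde tau psi psi2 tht *m Lstilde_inv (2 * tau) h psi2 thx (2 * tht)
         *m Rstilde tau psi psi2 tht *m Ltilde tau h psi thx tht.

Definition Mstilde (omega tau h : R) psi psi2 (nu1 nu2 : nat) thx tht :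
  'M[R[i]]_((N + N) + (N + N)) :=
  Stilde omega tau h psi thx tht ^+ nu2 *m Kstilde tau h psi psi2 thx tht
  *m Stilde omega tau h psi thx tht ^+ nu1.

Definition stack4 (U1 U2 U3 U4 : 'M[R[i]]_N) : 'M[R[i]]_((N + N) + (N + N), N) :=
  col_mx (col_mx U1 U2) (col_mx U3 U4).

End Symbols.

(* Main.v *)
Require Import Defs.
From HB Require Import structures.
From mathcomp Require Import all_boot all_order all_algebra.
From mathcomp Require Import all_classical all_reals all_analysis.
From mathcomp Require Import complex qpoly ring lra.
From mathcomp Require polyrcf.

Set Implicit Arguments.
Unset Strict Implicit.
Unset Printing Implicit Defensive.

Import Order.TTheory GRing.Theory Num.Theory.
Import numFieldNormedType.Exports.
Local Open Scope classical_set_scope.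
Local Open Scope ring_scope.
Local Open Scope complex_scope.

(** Every operator of the cycle is invariant under spatial shifts and maps a
    Fourier mode to a Fourier mode, multiplying its coefficient vector by a
    symbol; restriction identifies the frequencies tht and gamma(tht), whose
    doubles agree modulo 2 pi, and prolongation splits them again. Two inverses
    need an argument. The global inverse of the block diagonal part exists because
    all its symbols K + s M with s >= 0 are invertible (testing the local problem
    with its solution p gives p(0) = p(tau) = 0 and s * int p^2 = 0, and testing
    with p' settles s = 0) and the discrete Fourier modes span. The coarse symbols
    are invertible because the coarse operator is assumed injective on the span of
    the two coarse modes. *)

(** * Algebraic preliminaries *)

Lemma unitmx_of_inj (F : fieldType) (n : nat) (A : 'M[F]_n) :
  (forall c : 'cV_n, A *m c = 0 -> c = 0) -> A \in unitmx.
Proof.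
move=> injA; rewrite -row_full_unit -cokermx_eq0; apply/eqP/matrixP => i j.
(* Every column of the cokernel matrix is killed by [A], hence vanishes; a zero cokernel means full
   rank. *)
have := injA (col j (cokermx A)).
rewrite colE mulmxA mulmx_coker mul0mx -colE => /(_ erefl)/matrixP/(_ i ord0).
by rewrite !mxE.
Qed.

(** With antiderivatives at hand, the integrals below reduce to endpoint values by the fundamental
    theorem of calculus. *)
Lemma primitive_exists (R : numFieldType) (p : {poly R}) :
  {P : {poly R} | P^`() = p}.
Proof.
(* At index 0 the quotient is a division by zero, which is 0; differentiation discards this
   coefficient. *)
exists (\poly_(i < (size p).+1) (p`_i.-1 / i%:R)).
apply/polyP => i; rewrite coef_deriv coef_poly ltnS.
case: ltnP => [_|sz]; last by rewrite mul0rn nth_default.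
by rewrite -[LHS]mulr_natr mulfVK// pnatr_eq0.
Qed.

(** * Discontinuous Galerkin matrices in time *)

Section PolyIntegral.
Variables (R : realType) (tau : R).
Hypothesis tau_gt0 : 0 < tau.

Definition pint (p : {poly R}) : R :=
  \int[lebesgue_measure]_(t in `[0, tau]) p.[t].

Lemma pint_deriv (P : {poly R}) : pint P^`() = P.[tau] - P.[0].
Proof.
rewrite /pint /Rintegral (@continuous_FTC2 _ _ (horner P))//.
- by apply: continuous_in_subspaceT => x _; exact: continuous_horner.
- split=> [x _||]; first exact: derivable_horner.
  + by apply: cvg_at_right_filter; exact: continuous_horner.
  + by apply: cvg_at_left_filter; exact: continuous_horner.
- by move=> x _; rewrite derivE.
Qed.

(** Linearity is read off the antiderivatives, which avoids integrability side conditions. *)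
Lemma pintP a (p q : {poly R}) : pint (a *: p + q) = a * pint p + pint q.
Proof.
have [P <-] := primitive_exists p.
have [Q <-] := primitive_exists q.
rewrite -derivZ -derivD !pint_deriv !hornerD !hornerZ.
by ring.
Qed.

HB.instance Definition _ := GRing.isLinear.Build R {poly R} R _ pint pintP.

(** The mean value theorem applied to an antiderivative of [p * p] writes the integral as a square
    times [tau]. *)
Lemma pint_sqr_ge0 (p : {poly R}) : 0 <= pint (p * p).
Proof.
have [P dP] := primitive_exists (p * p).
rewrite -dP pint_deriv; have [c _ ->] := polyrcf.poly_mvt P tau_gt0.
by rewrite dP hornerM -expr2 mulr_ge0 ?sqr_ge0 ?subr_ge0 ?ltW.
Qed.

(** An antiderivative [P] of [p * p] is nondecreasing. Equal values at 0 and [tau] make it constant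
    in between, so [P - P.[0]%:P] has too many roots to be nonzero, and its derivative [p * p]
    vanishes. *)
Lemma pint_sqr_eq0 (p : {poly R}) : pint (p * p) = 0 -> p = 0.
Proof.
have [P dP] := primitive_exists (p * p).
have ndP x y : x <= y -> P.[x] <= P.[y].
  rewrite le_eqVlt => /predU1P[->//|xy]; rewrite -subr_ge0.
  have [c _ ->] := polyrcf.poly_mvt P xy.
  by rewrite dP hornerM -expr2 mulr_ge0 ?sqr_ge0 ?subr_ge0 ?ltW.
rewrite -dP pint_deriv => /eqP; rewrite subr_eq0 => /eqP P0tau.
pose s := size (P - P.[0]%:P).
(* Distinct points of (0, tau], as many as the size of the polynomial, which exceeds the degree of a
   nonzero one. *)
pose rs := [seq tau / i.+1%:R | i <- iota 0 s].
have /eqP : P - P.[0]%:P = 0.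
  apply: (@roots_geq_poly_eq0 _ _ rs); last by rewrite size_map size_iota.
    apply/allP => _ /mapP[i _ ->]; rewrite rootE !hornerE subr_eq0 eq_le.
    rewrite -{1}P0tau !ndP//; first by rewrite divr_ge0// ltW.
    by rewrite ler_pdivrMr// ler_peMr ?ler1n// ltW.
  rewrite map_inj_uniq ?iota_uniq// => i j /(mulfI (lt0r_neq0 tau_gt0)).
  by move/invr_inj/eqP; rewrite eqr_nat => /eqP[].
rewrite subr_eq0 => /eqP PE; move: dP; rewrite PE derivC => /esym/eqP.
by rewrite mulf_eq0 orbb => /eqP.
Qed.

(* Galerkin form of p' + s p on (0, tau), with upwind jump at t = 0. *)
Definition dg_form (s : R) (q p : {poly R}) : R :=
  - pint (p * q^`()) + p.[tau] * q.[tau] + s * pint (p * q).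

Lemma dg_form_is_linear s q : scalar (dg_form s q).
Proof.
by move=> a p p'; rewrite /dg_form !mulrDl -!scalerAl !pintP !hornerD !hornerZ /=; ring.
Qed.

HB.instance Definition _ s q :=
  GRing.isLinear.Build R {poly R} R _ (dg_form s q) (dg_form_is_linear s q).

(** Integration by parts: the boundary term at [tau] cancels and the one at 0 remains. *)
Lemma dg_formC s (q p : {poly R}) :
  dg_form s q p = pint (q * p^`()) + p.[0] * q.[0] + s * pint (p * q).
Proof.
have := pint_deriv (p * q); rewrite derivM linearD /= !hornerM /dg_form.
by rewrite (mulrC q p^`()); lra.
Qed.

Lemma dg_form_nondegenerate (s : R) (N : nat) (p : {poly R}) :
  0 <= s -> (size p <= N)%N ->
  (forall q : {poly R}, (size q <= N)%N -> dg_form s q p = 0) -> p = 0.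
Proof.
move=> s_ge0 szp p_ker.
(* The two forms of the equation tested with [p] add up to p(0)^2 + p(tau)^2 + 2 s int p^2 = 0,
   where each term is nonnegative. *)
have E1 := p_ker p szp; have E2 := E1; rewrite dg_formC in E2; rewrite /dg_form in E1.
have p2_ge0 := pint_sqr_ge0 p.
have sp_ge0 : 0 <= s * pint (p * p) by rewrite mulr_ge0.
have sp0 : s * pint (p * p) = 0.
  have := sqr_ge0 p.[0]; have := sqr_ge0 p.[tau]; rewrite !expr2; lra.
have p00 : p.[0] = 0.
  have := sqr_ge0 p.[tau] => h; apply/eqP; rewrite -sqrf_eq0; apply/eqP.
  have := sqr_ge0 p.[0]; rewrite !expr2 in h *; lra.
have [/eqP|s_neq0] := eqVneq s 0; last first.
  move/eqP: sp0; rewrite mulf_eq0 (negPf s_neq0) => /eqP; exact: pint_sqr_eq0.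
move=> /eqP s0.
have szdp : (size p^`() <= N)%N.
  by rewrite (leq_trans _ szp)// (leq_trans (size_poly _ _))// leq_pred.
(* For s = 0 and p(0) = 0, testing with p' leaves int p'^2 = 0, so [p] is a constant vanishing at
   0. *)
have := p_ker _ szdp; rewrite dg_formC s0 mul0r addr0 p00 mul0r addr0.
move=> /pint_sqr_eq0 dp0.
have pE : p = (p`_0)%:P.
  apply/polyP => -[|i]; rewrite coefC//=.
  by have /polyP/(_ i)/eqP := dp0; rewrite coef_deriv coef0 mulrn_eq0 => /eqP.
by move: p00; rewrite pE hornerC => ->.
Qed.

Lemma dg_matrixE (s : R) (N : nat) (psi : N.-tuple {poly_N R}) (c : 'cV[R]_N) k :
  ((Ktau tau psi + s *: Mtau tau psi) *m c) k ord0 =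
  dg_form s (tnth psi k) (\sum_l c l ord0 *: (tnth psi l : {poly R})).
Proof.
rewrite mxE linear_sum; apply: eq_bigr => l _; rewrite linearZ /= mulrC.
congr (_ * _); rewrite !mxE /dg_form /pint.
by congr (- _ + _ + s * _); apply: eq_Rintegral => t _; rewrite hornerM.
Qed.

(** A kernel vector holds the coordinates of a polynomial that is orthogonal, in [dg_form], to every
    basis function and hence to every test polynomial; nondegeneracy and freeness of the basis make
    it zero. *)
Lemma dg_matrix_unit (s : R) (N : nat) (psi : N.-tuple {poly_N R}) :
  0 <= s -> basis_of fullv psi -> Ktau tau psi + s *: Mtau tau psi \in unitmx.
Proof.
move=> s_ge0 psi_basis; apply: unitmx_of_inj => c /matrixP Ac0.
pose p : {poly_N R} := \sum_l c l ord0 *: tnth psi l.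
have pE : \sum_l c l ord0 *: (tnth psi l : {poly R}) = p.
  by rewrite /p linear_sum; apply: eq_bigr => l _; rewrite linearZ.
have p0 : p = 0.
  apply/val_inj; apply: (dg_form_nondegenerate s_ge0 (size_npoly p)).
  (* The registered linear structure concerns the trial argument; this is linearity in the test
     argument. *)
  have lin a q r : dg_form s (a *: q + r) p = a * dg_form s q p + dg_form s r p.
    by rewrite !dg_formC mulrDl mulrDr -scalerAl -scalerAr !pintP !hornerD !hornerZ /=; ring.
  have form0 : dg_form s 0 p = 0 by rewrite dg_formC mulr0 mul0r linear0 horner0; ring.
  move=> q szq; rewrite -(npolypK szq) (coord_basis psi_basis (memvf (npolyp N q))).
  rewrite linear_sum /=; elim/big_ind: _ => // [x y x0 y0|k _].
    by rewrite -[x]scale1r lin x0 y0 mulr0 addr0.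
  rewrite -tnth_nth -[X in dg_form s X]addr0 lin form0 addr0.
  by rewrite -pE -dg_matrixE Ac0 mxE mulr0.
have /freeP psi_free := basis_free psi_basis.
apply/colP => l; rewrite mxE; apply: (psi_free (fun l => c l ord0)).
by rewrite -[RHS]p0; apply: eq_bigr => i _; rewrite (tnth_nth 0).
Qed.

End PolyIntegral.

(** * Fourier modes *)

Section Cis.
Variable R : realType.
Implicit Types x y : R.

Lemma cisD x y : cis (x + y) = cis x * cis y.
Proof.
rewrite /cis cosD sinD; apply/eqP.
by rewrite eq_complex /= (addrC (sin x * _)) !eqxx.
Qed.

Lemma cis0 : cis (0 : R) = 1.
Proof. by rewrite /cis cos0 sin0. Qed.

Lemma cisK x : cis x * cis (- x) = 1.
Proof. by rewrite -cisD subrr cis0. Qed.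

Lemma cis_neq0 x : cis x != 0.
Proof. by apply/eqP => x0; move/eqP: (cisK x); rewrite x0 mul0r eq_sym oner_eq0. Qed.

Lemma cisN x : cis (- x) = (cis x)^-1.
Proof. by apply: (mulfI (cis_neq0 x)); rewrite cisK divff// cis_neq0. Qed.

Lemma cisX n x : cis (n%:R * x) = cis x ^+ n.
Proof.
elim: n => [|n IH]; first by rewrite mul0r cis0.
by rewrite -natr1 mulrDl mul1r cisD IH exprSr.
Qed.

Lemma cis_pi : cis (pi : R) = -1.
Proof. by rewrite /cis cospi sinpi; apply/eqP; rewrite eq_complex /= oppr0 !eqxx. Qed.

Lemma cis_gamma x : cis (gamma_freq x) = - cis x.
Proof.
rewrite /gamma_freq; case: ifP => _; rewrite ?mul1r ?mulN1r ?opprK cisD ?cisN cis_pi.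
  by rewrite invrN invr1 mulrN1.
by rewrite mulrN1.
Qed.

Lemma cisNgamma x : cis (- gamma_freq x) = - cis (- x).
Proof. by rewrite !cisN cis_gamma invrN. Qed.

Lemma cis_add_cisN x : cis (- x) + cis x = (2 * cos x)%:C.
Proof.
rewrite /cis cosN sinN; apply/eqP.
by rewrite eq_complex /= addNr mulr_natl mulr2n !eqxx.
Qed.

Lemma cis_2pi : cis (2 * pi : R) = 1.
Proof. by rewrite cisX cis_pi expr2 mulrNN mulr1. Qed.

(** By the half-angle formula the real part is 1 - 2 sin(x/2)^2, which is below 1. *)
Lemma cis_neq1 x : 0 < x < 2 * pi -> cis x != 1.
Proof.
move=> /andP[x_gt0 x_lt].
have -> : x = (x / 2) *+ 2 by rewrite -mulr_natr; field.
have : 0 < sin (x / 2) by apply: sin_gt0_pi; lra.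
rewrite /cis eq_complex /= cos_mulr2n => s_gt0.
have -> : cos (x / 2) ^+ 2 = 1 - sin (x / 2) ^+ 2.
  by have := cos2Dsin2 (x / 2); lra.
have : 0 < sin (x / 2) ^+ 2 by rewrite exprn_gt0.
by move=> ?; rewrite negb_and; apply/orP; left; apply/eqP; lra.
Qed.

Lemma cis_prim_root n : (0 < n)%N -> n.-primitive_root (cis (2 * pi / n%:R : R)).
Proof.
move=> n_gt0; have n0 : (0 : R) < n%:R by rewrite ltr0n.
rewrite /primitive_root_of_unity n_gt0; apply/forallP => i.
rewrite unity_rootE -cisX; have [->|ne] := eqVneq i.+1 n.
  by rewrite mulrC divfK ?lt0r_neq0// cis_2pi eqxx.
rewrite eqbF_neg; apply: cis_neq1.
have pi2 : 0 < 2 * pi :> R by have := pi_gt0 R; lra.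
rewrite mulrA divr_gt0 ?(mulr_gt0 _ pi2) ?ltr0n//= ltr_pdivrMr// mulrC ltr_pM2l//.
by rewrite ltr_nat ltn_neqAle ne ltn_ord.
Qed.

(** Periodicity absorbs the wrap-around of the cyclic index, so a shift is multiplication by a
    phase. *)
Lemma cis_ordS n x (i : 'I_n) : cis (n%:R * x) = 1 ->
  cis ((ordS i).+1%:R * x) = cis x * cis (i.+1%:R * x).
Proof. by rewrite !cisX => xn1; rewrite exprS expr_mod// -exprS. Qed.

Lemma cis_ord_pred n x (i : 'I_n) : cis (n%:R * x) = 1 ->
  cis ((ord_pred i).+1%:R * x) = cis (- x) * cis (i.+1%:R * x).
Proof.
rewrite !cisX => xn1; rewrite exprS expr_mod//.
(* [ord_pred i] is [(i + n).-1] modulo [n]; positivity of [i + n] makes the truncated predecessor a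
   true one. *)
have /prednK : (0 < i + n)%N by rewrite addn_gt0 (leq_ltn_trans _ (ltn_ord i)) ?orbT.
move=> E; rewrite -exprS E exprD xn1 mulr1 exprS mulrA [_ * cis x]mulrC cisK mul1r.
by [].
Qed.

Lemma freqs_periodic n x : (0 < n)%N -> freqs n x -> cis (n%:R * x) = 1.
Proof.
move=> n_gt0 [k [_ _ ->]].
rewrite mulrC divfK ?pnatr_eq0 -?lt0n//.
have -> : 2 * k%:~R * pi = k%:~R * (2 * pi) :> R by ring.
case: k => k; first by rewrite cisX cis_2pi expr1n.
by rewrite NegzE mulrNz mulNr cisN pmulrn cisX cis_2pi expr1n invr1.
Qed.

(** [gamma_freq] flips the sign of the phase, and an even power of -1 is 1. *)
Lemma gamma_periodic n x : ~~ odd n -> cis (n%:R * x) = 1 ->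
  cis (n%:R * gamma_freq x) = 1.
Proof. by move=> /negPf n_even; rewrite !cisX cis_gamma exprNn -signr_odd n_even mul1r. Qed.

End Cis.

(** * Modes and the symbols of the spatial stencils *)

Section Modes.
Variables (R : realType) (nt nx N : nat).
Local Notation V := (stvec R nt nx N).

(** A Fourier mode in space only, with arbitrary time dependence: the block diagonal part acts
    within each time step, so this suffices to invert it. *)
Definition smode (thx : R) (c : 'I_nt -> 'cV[R[i]]_N) : V :=
  [ffun p : 'I_nt * 'I_nx => cis (p.2.+1%:R * thx) *: c p.1].

Definition mode (thx tht : R) (c : 'cV[R[i]]_N) : V :=
  smode thx (fun i => cis (i.+1%:R * tht) *: c).

(** [Phi] is a phase times the all-ones vector, so a coefficient matrix enters only through its
    product with that vector; modes can therefore carry coefficient vectors. *)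
Lemma mulmx_Phi thx tht (U : 'M[R[i]]_N) p :
  U *m Phi nt nx N thx tht p = mode thx tht (U *m const_mx 1) p.
Proof. by rewrite !ffunE -scalemxAr scalerA mulrC. Qed.

Lemma mode_is_linear thx tht : linear (mode thx tht).
Proof.
by move=> a c d; apply/ffunP => p; rewrite !ffunE; apply/colP => j; rewrite !mxE; ring.
Qed.

HB.instance Definition _ thx tht :=
  GRing.isLinear.Build R[i] 'cV[R[i]]_N V _ (mode thx tht) (mode_is_linear thx tht).

(** The eigenvalue of [Mh] on a spatial mode. *)
Definition mass_sym (h thx : R) : R := h / 3 * (2 + cos thx).

Lemma cos_gtN2 (thx : R) : 0 < 2 + cos thx.
Proof. by have := cos_geN1 thx; lra. Qed.

Lemma mass_sym_gt0 h thx : 0 < h -> 0 < mass_sym h thx.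
Proof. by move=> h_gt0; rewrite mulr_gt0 ?divr_gt0// cos_gtN2. Qed.

Lemma beta_sym_ge0 (thx : R) : 0 <= beta_sym thx.
Proof. by rewrite /beta_sym mulr_ge0// divr_ge0 ?(ltW (cos_gtN2 _)). Qed.

Lemma Mh_smode h thx c : cis (nx%:R * thx) = 1 ->
  Mh h (smode thx c) = smode thx (fun i => (mass_sym h thx)%:C *: c i).
Proof.
move=> x1; apply/ffunP => p; rewrite !ffunE /= cis_ordS// cis_ord_pred//.
apply/colP => j; rewrite !mxE.
have -> : (mass_sym h thx)%:C = (h / 6)%:C * (cis (- thx) + cis thx + 4).
  rewrite cis_add_cisN -[4](rmorph_nat (real_complex R)) -rmorphD -rmorphM /=.
  by congr (_%:C); rewrite /mass_sym; field.
ring.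
Qed.

(** The eigenvalue (2 - 2 cos thx) / h is written with the factor [mass_sym], which then factors out
    of the whole system symbol. *)
Lemma Kh_smode h thx c : h != 0 -> cis (nx%:R * thx) = 1 ->
  Kh h (smode thx c) =
  smode thx (fun i => (mass_sym h thx)%:C *: ((h ^- 2 * beta_sym thx)%:C *: c i)).
Proof.
move=> h0 x1; apply/ffunP => p; rewrite !ffunE /= cis_ordS// cis_ord_pred//.
apply/colP => j; rewrite !mxE (mulrA (mass_sym h thx)%:C) -rmorphM /=.
have -> : (mass_sym h thx * (h ^- 2 * beta_sym thx))%:C =
          (h^-1)%:C * (2 - (cis (- thx) + cis thx)).
  rewrite cis_add_cisN -[X in X - _](rmorph_nat (real_complex R)) -rmorphB -rmorphM /=.
  congr (_%:C); rewrite /mass_sym /beta_sym; field.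
  by rewrite h0 lt0r_neq0// cos_gtN2.
ring.
Qed.

End Modes.

(** * Discrete Fourier inversion in space *)

Section Fourier.
Variables (R : realType) (nt nx N : nat).
Local Notation V := (stvec R nt nx N).
Local Notation freq k := (k%:R * (2 * pi / nx%:R) : R).

Lemma freq_periodic (k : nat) : (0 < nx)%N -> cis (nx%:R * freq k) = 1.
Proof.
move=> nx_gt0; rewrite mulrCA cisX mulrC divfK ?pnatr_eq0 -?lt0n//.
by rewrite cis_2pi expr1n.
Qed.

Lemma sum_cis_freq (r s : 'I_nx) :
  \sum_(k < nx) cis (r.+1%:R * freq k) * cis (- (s.+1%:R * freq k)) =
  (if r == s then nx%:R else 0).
Proof.
have nx_gt0 : (0 < nx)%N by rewrite (leq_ltn_trans _ (ltn_ord r)).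
set z := cis (2 * pi / nx%:R : R).
(* The sum is geometric in w = z^(r - s), an [nx]-th root of unity that is 1 only for r = s. *)
have prz : nx.-primitive_root z := cis_prim_root R nx_gt0.
pose w := z ^+ r.+1 / z ^+ s.+1.
transitivity (\sum_(k < nx) w ^+ k).
  apply: eq_bigr => k _; rewrite cisN !(mulrCA _ k%:R) !cisX -/z.
  by rewrite /w expr_div_n.
case: eqVneq => [rs|r_neq_s].
  rewrite /w rs divff ?expf_neq0 ?cis_neq0//.
  by under eq_bigr do rewrite expr1n; rewrite sumr_const card_ord.
have w1 : w - 1 != 0.
  rewrite subr_eq0; apply: contra r_neq_s => /eqP wE.
  have : z ^+ r.+1 == z ^+ s.+1.
    move/(congr1 (fun x => x * z ^+ s.+1)): wE.
    by rewrite /w divfK ?expf_neq0 ?cis_neq0// mul1r => ->.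
  rewrite !exprS (inj_eq (mulfI (cis_neq0 _))) (eq_prim_root_expr prz).
  by rewrite !modn_small.
(* Multiplied by w - 1, the geometric sum becomes w^nx - 1 = 0. *)
apply: (mulfI w1); rewrite -subrX1 mulr0 /w expr_div_n -!exprM.
by rewrite ![(_ * nx)%N]mulnC !exprM (prim_expr_order prz) !expr1n divr1 subrr.
Qed.

Definition dft (w : V) (k : 'I_nx) (i : 'I_nt) : 'cV[R[i]]_N :=
  nx%:R^-1 *: \sum_(s < nx) cis (- (s.+1%:R * freq k)) *: w (i, s).

Lemma dft_inversion (w : V) : w = \sum_(k < nx) smode nx (freq k) (dft w k).
Proof.
apply/ffunP => -[i r]; rewrite sum_ffunE.
transitivity (nx%:R^-1 *: \sum_(s < nx) (if r == s then nx%:R else 0) *: w (i, s)).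
  rewrite (bigD1 r)//= eqxx big1 ?addr0 => [|s /negPf]; last first.
    by rewrite eq_sym => ->; rewrite scale0r.
  rewrite scalerA mulVf ?scale1r// pnatr_eq0 -lt0n.
  by rewrite (leq_ltn_trans _ (ltn_ord r)).
under eq_bigr do rewrite -sum_cis_freq scaler_suml.
rewrite exchange_big scaler_sumr; apply: eq_bigr => k _; rewrite ffunE /dft /=.
rewrite !scaler_sumr; apply: eq_bigr => s _; rewrite !scalerA; congr (_ *: _).
by rewrite mulrCA mulrA.
Qed.

End Fourier.

(** * Symbols of the system operator and the smoother *)

Section FieldIdentities.
Variables (F : fieldType) (m : nat).
Implicit Types (A B : 'M[F]_m) (c u v : 'cV[F]_m).

Lemma mass_stencil_linear (a b d : F) u1 u2 u3 v1 v2 v3 :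
  b *: ((a *: u1 + v1) + d *: (a *: u2 + v2) + (a *: u3 + v3)) =
  a *: (b *: (u1 + d *: u2 + u3)) + b *: (v1 + d *: v2 + v3).
Proof. by apply/colP => j; rewrite !mxE; ring. Qed.

Lemma stiffness_stencil_linear (a b d : F) u1 u2 u3 v1 v2 v3 :
  b *: (- (a *: u1 + v1) + d *: (a *: u2 + v2) - (a *: u3 + v3)) =
  a *: (b *: (- u1 + d *: u2 - u3)) + b *: (- v1 + d *: v2 - v3).
Proof. by apply/colP => j; rewrite !mxE; ring. Qed.

(** Here [x] and [t] are the phases in space and time, [s] is the mass eigenvalue and [e] is the
    phase of one step back in time. *)
Lemma step_symbolE (x t s e : F) A B c :
  x *: ((s *: A) *m (t *: c)) - B *m (x *: (s *: ((e * t) *: c))) =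
  x *: (t *: ((s *: (A - e *: B)) *m c)).
Proof.
rewrite -!scalemxAr -!scalemxAl mulmxBl -!scalemxAl !scalerA !scalerBr !scalerA.
by congr (_ *: _ - _ *: _); ring.
Qed.

(** Pulling out the symbol of the block diagonal part exhibits what its inverse leaves of the system
    symbol. *)
Lemma step_symbol_factor (e : F) A B c : A \in unitmx ->
  (A - e *: B) *m c = A *m (c - e *: (invmx A *m B *m c)).
Proof.
move=> Au; rewrite mulmxBl mulmxBr -scalemxAl -scalemxAr !mulmxA mulmxV//.
by rewrite mul1mx.
Qed.

Lemma jacobi_symbolE (w e : F) A c :
  c - w *: (c - e *: (A *m c)) = ((1 - w)%:M + (w * e) *: A) *m c.
Proof.
rewrite mulmxDl mul_scalar_mx -scalemxAl scalerBr scalerA opprB scalerBl scale1r.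
by rewrite addrA addrAC.
Qed.

End FieldIdentities.

Section Smoothing.
Variables (R : realType) (nt nx N : nat) (tau h : R).
Variable psi : N.-tuple {poly_N R}.
Hypotheses (nx_gt0 : (0 < nx)%N) (tau_gt0 : 0 < tau) (h_gt0 : 0 < h).
Hypothesis psi_basis : basis_of fullv psi.
Local Notation V := (stvec R nt nx N).

Lemma ffun_linearE a (u v : V) p : (a *: u + v) p = a *: u p + v p.
Proof. by rewrite !ffunE. Qed.

Lemma ffun_subE (u v : V) p : (u - v) p = u p - v p.
Proof. by rewrite !ffunE. Qed.

Lemma smodeE thx (c : 'I_nt -> 'cV[R[i]]_N) (p : 'I_nt * 'I_nx) :
  smode nx thx c p = cis (p.2.+1%:R * thx) *: c p.1.
Proof. by rewrite ffunE. Qed.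

Lemma Mh_is_linear : linear (@Mh R nt nx N h).
Proof.
by move=> a u v; apply/ffunP => p; rewrite !ffunE mass_stencil_linear.
Qed.
HB.instance Definition _ := GRing.isLinear.Build R[i] V V _ (@Mh R nt nx N h) Mh_is_linear.

Lemma Kh_is_linear : linear (@Kh R nt nx N h).
Proof.
by move=> a u v; apply/ffunP => p; rewrite !ffunE stiffness_stencil_linear.
Qed.
HB.instance Definition _ := GRing.isLinear.Build R[i] V V _ (@Kh R nt nx N h) Kh_is_linear.

Lemma DopE (u : V) p :
  Dop tau h psi u p = mxC (Ktau tau psi) *m Mh h u p + mxC (Mtau tau psi) *m Kh h u p.
Proof. by rewrite {1}/Dop ffunE. Qed.

Lemma Dop_is_linear : linear (@Dop R nt nx N tau h psi).
Proof.
move=> a u v; apply/ffunP => p; rewrite [RHS]ffun_linearE.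
rewrite [LHS]DopE [X in _ = a *: X + _]DopE [X in _ = _ + X]DopE.
rewrite (Mh_is_linear a u v) (Kh_is_linear a u v).
rewrite (ffun_linearE a (Mh h u)) (ffun_linearE a (Kh h u)).
by rewrite !mulmxDr -!scalemxAr addrACA -scalerDr.
Qed.
HB.instance Definition _ :=
  GRing.isLinear.Build R[i] V V _ (@Dop R nt nx N tau h psi) Dop_is_linear.

Lemma Lop_Dop (u : V) : Lop tau h psi u =
  Dop tau h psi u - [ffun p => mxC (Ntau tau psi) *m Mh h u (ord_pred p.1, p.2)].
Proof. by apply/ffunP => p; rewrite [RHS]ffunE DopE !ffunE. Qed.

Lemma Lop_is_linear : linear (@Lop R nt nx N tau h psi).
Proof.
move=> a u v; rewrite !Lop_Dop linearP scalerBr addrACA -opprD; congr (_ - _).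
apply/ffunP => p; rewrite [RHS]ffun_linearE !(ffunE _ p) (Mh_is_linear a u v).
by rewrite (ffun_linearE a (Mh h u)) mulmxDr -scalemxAr.
Qed.
HB.instance Definition _ :=
  GRing.isLinear.Build R[i] V V _ (@Lop R nt nx N tau h psi) Lop_is_linear.

Definition dg_symbol thx : 'M[R[i]]_N :=
  mxC (Ktau tau psi) + (h ^- 2 * beta_sym thx)%:C *: mxC (Mtau tau psi).

(** The real matrix K + s M has s = h^-2 beta >= 0, and invertibility passes to the complex
    numbers. *)
Lemma dg_symbol_unit thx : dg_symbol thx \in unitmx.
Proof.
have -> : dg_symbol thx =
          mxC (Ktau tau psi + (h ^- 2 * beta_sym thx) *: Mtau tau psi).
  by rewrite /mxC map_mxD map_mxZ.
rewrite map_unitmx dg_matrix_unit// mulr_ge0 ?beta_sym_ge0//.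
by rewrite invr_ge0 exprn_ge0// ltW.
Qed.

Lemma Dop_smode thx (c : 'I_nt -> 'cV[R[i]]_N) : cis (nx%:R * thx) = 1 ->
  Dop tau h psi (smode nx thx c) =
  smode nx thx (fun i => ((mass_sym h thx)%:C *: dg_symbol thx) *m c i).
Proof.
move=> x1; apply/ffunP => p; rewrite DopE Mh_smode// Kh_smode ?lt0r_neq0// !ffunE.
rewrite /dg_symbol -scalemxAl mulmxDl -scalemxAl.
by rewrite -!scalemxAr -!scalerDr.
Qed.

Lemma massC_neq0 thx : (mass_sym h thx)%:C != 0.
Proof. by rewrite fmorph_eq0 lt0r_neq0// mass_sym_gt0. Qed.

(** The formal inverse of a linear map is a left inverse once the kernel is trivial. By rank-nullity
    surjectivity suffices, and it can be checked on the spatial modes, which span. *)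
Lemma DinvK : cancel (@Dop R nt nx N tau h psi) (Dinv tau h psi).
Proof.
move=> u; rewrite /Dinv -[X in (_^-1)%VF X]lfunE lker0_lfunK//.
rewrite -dimv_eq0; have := limg_ker_dim (linfun (@Dop R nt nx N tau h psi)) fullv.
rewrite capfv; suff -> : limg (linfun (@Dop R nt nx N tau h psi)) = fullv.
  by move/eqP; rewrite -[X in _ == X]add0n eqn_add2r.
apply/eqP; rewrite eqEsubv subvf; apply/subvP => w _.
rewrite [w]dft_inversion; apply: memv_suml => k _.
set th := (_ * _ : R); have x1 := freq_periodic R k nx_gt0.
(* The preimage of one spatial mode: its symbol is inverted separately at every time step. *)
pose c i := invmx ((mass_sym h th)%:C *: dg_symbol th) *m dft w k i.
apply/memv_imgP; exists (smode nx th c); rewrite ?memvf// lfunE /= Dop_smode//.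
apply/ffunP => p; rewrite !ffunE /c mulKVmx// unitmxZ ?dg_symbol_unit//.
by rewrite unitfE massC_neq0.
Qed.

Lemma Lop_mode thx tht c : cis (nx%:R * thx) = 1 -> cis (nt%:R * tht) = 1 ->
  Lop tau h psi (mode nt nx thx tht c) = mode nt nx thx tht (Lhat tau h psi thx tht *m c).
Proof.
move=> x1 t1; rewrite Lop_Dop Dop_smode// Mh_smode//; apply/ffunP => p.
rewrite [RHS]smodeE [LHS]ffun_subE [X in X - _]smodeE [X in _ - X]ffunE.
rewrite [X in _ - _ *m X]smodeE /= (cis_ord_pred _ t1).
exact: step_symbolE.
Qed.

Lemma Smoother_step omega thx tht c :
  cis (nx%:R * thx) = 1 -> cis (nt%:R * tht) = 1 ->
  mode nt nx thx tht c - omega%:C *: Dinv tau h psi (Lop tau h psi (mode nt nx thx tht c)) =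
  mode nt nx thx tht (Shat omega tau h psi thx tht *m c).
Proof.
move=> x1 t1; rewrite Lop_mode//.
set A := dg_symbol thx; set B := mxC (Ntau tau psi).
(* The residual is displayed as the block diagonal part of an explicit mode, which [DinvK] then
   recovers. *)
have -> : mode nt nx thx tht (Lhat tau h psi thx tht *m c) =
          Dop tau h psi (mode nt nx thx tht (c - cis (- tht) *: (invmx A *m B *m c))).
  rewrite Dop_smode//; congr smode; apply/funext => i.
  rewrite -[RHS]scalemxAr; congr (_ *: _).
  by rewrite -[RHS]scalemxAl -(step_symbol_factor _ _ _ (dg_symbol_unit thx)) scalemxAl.
rewrite DinvK -linearZ -linearB /=; congr mode.
rewrite jacobi_symbolE; have -> : 1 - omega%:C = (1 - omega)%:C by rewrite rmorphB rmorph1.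
by [].
Qed.

End Smoothing.

(** * Symbols of restriction and prolongation *)

Section TransferIdentities.
Variables (F : numFieldType) (m : nat).
Implicit Types (A B : 'M[F]_m) (d : 'cV[F]_m).

Lemma restriction_symbolE (x z e : F) A B d :
  A *m (x *: ((e * z) *: d)) + B *m (x *: (z *: d)) = x *: (z *: ((e *: A + B) *m d)).
Proof.
rewrite -!scalemxAr mulmxDl -scalemxAl !scalerDr !scalerA; congr (_ *: _ + _).
by ring.
Qed.

(** At odd steps the phases for tht and its gamma shift are opposite: the [B] terms cancel, the [A]
    terms double, and the factor 1/2 compensates. *)
Lemma prolongation_symbol_odd (x z e : F) A B d :
  x *: (z *: ((2^-1 *: (e *: A + B)) *m d)) +
  x *: ((- z) *: ((2^-1 *: ((- e) *: A + B)) *m d)) = A *m (x *: ((e * z) *: d)).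
Proof.
rewrite -!scalemxAr -!scalemxAl !mulmxDl -!scalemxAl !scalerA.
by apply/colP => j; rewrite !mxE; field.
Qed.

(** At even steps the two phases agree, so now the [A] terms cancel. *)
Lemma prolongation_symbol_even (x z e : F) A B d :
  x *: (z *: ((2^-1 *: (e *: A + B)) *m d)) +
  x *: (z *: ((2^-1 *: ((- e) *: A + B)) *m d)) = B *m (x *: (z *: d)).
Proof.
rewrite -!scalemxAr -!scalemxAl !mulmxDl -!scalemxAl !scalerA.
by apply/colP => j; rewrite !mxE; field.
Qed.

End TransferIdentities.

(** Aliasing: tht and its gamma shift give the same mode on the coarse time grid. *)
Lemma cis_double_gamma (R : realType) n (x : R) :
  cis (n%:R * (2 * gamma_freq x)) = cis (n%:R * (2 * x)).
Proof. by rewrite !cisX cis_gamma sqrrN. Qed.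

Section Transfer.
Variables (R : realType) (nt nx N : nat) (tau : R).
Variables psi psi2 : N.-tuple {poly_N R}.

Lemma cis_even_step (i : 'I_nt./2) (tht : R) :
  cis ((even_step i).+1%:R * tht) = cis (i.+1%:R * (2 * tht)).
Proof. by rewrite mulrA -natrM muln2 doubleS. Qed.

Lemma cis_odd_step (i : 'I_nt./2) (tht : R) :
  cis ((odd_step i).+1%:R * tht) = cis (- tht) * cis (i.+1%:R * (2 * tht)).
Proof.
rewrite -cis_even_step -cisD; congr cis.
by rewrite /= -(natr1 i.*2.+1) mulrDl mul1r addrC addrK.
Qed.

Lemma Rs_mode thx tht c :
  Rs tau psi psi2 (mode nt nx thx tht c) =
  mode nt./2 nx thx (2 * tht) (Rhat tau psi psi2 tht *m c).
Proof.
apply/ffunP => p; rewrite [RHS]smodeE [LHS]ffunE.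
rewrite [X in _ *m X + _]smodeE [X in _ + _ *m X]smodeE /= cis_odd_step cis_even_step.
exact: restriction_symbolE.
Qed.

(** These are the matrix entries of restriction, needed because prolongation is defined as its
    transpose. *)
Lemma Rs_unit_vec (m : 'I_nt) (r : 'I_nx) k (p : 'I_nt./2 * 'I_nx) j :
  Rs tau psi psi2 (unit_vec R (m, r) k) p j ord0 =
  (if odd_step p.1 == m then mxC (R1 tau psi psi2) j k else 0) *+ (p.2 == r)
  + (if even_step p.1 == m then mxC (R2 tau psi psi2) j k else 0) *+ (p.2 == r).
Proof.
rewrite ffunE mxE; congr (_ + _); rewrite ffunE xpair_eqE.
  case: eqP => _ /=; last by rewrite mulmx0 mxE mul0rn.
  case: eqP => _ /=; last by rewrite mulmx0 mxE.
  by rewrite -colE mxE.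
case: eqP => _ /=; last by rewrite mulmx0 mxE mul0rn.
case: eqP => _ /=; last by rewrite mulmx0 mxE.
by rewrite -colE mxE.
Qed.

Lemma odd_step_neq_even (i k : 'I_nt./2) : (odd_step i == even_step k) = false.
Proof. by apply/eqP => /(congr1 val)/(congr1 odd); rewrite /= !odd_double. Qed.

Lemma odd_step_inj : injective (@odd_step nt).
Proof. by move=> i k /(congr1 val) /= /double_inj ik; apply: val_inj. Qed.

Lemma even_step_inj : injective (@even_step nt).
Proof. by move=> i k /(congr1 val) /= [] /double_inj ik; apply: val_inj. Qed.

(** Each fine step contributes to exactly one coarse step, so one summand of the transpose
    survives. *)
Lemma Ps_odd_step (w : stvec R nt./2 nx N) i r :
  Ps tau psi psi2 w (odd_step i, r) = mxC (R1 tau psi psi2)^T *m w (i, r).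
Proof.
rewrite ffunE; apply/colP => k; rewrite !mxE (bigD1 (i, r))//= [X in _ + X]big1 ?addr0.
  apply: eq_bigr => j _; rewrite Rs_unit_vec !eqxx [even_step _ == _]eq_sym.
  by rewrite odd_step_neq_even addr0 !mxE.
move=> [i2 r2] /negPf p_neq; rewrite big1// => j _.
rewrite Rs_unit_vec (inj_eq odd_step_inj) [even_step _ == _]eq_sym odd_step_neq_even.
rewrite mul0rn addr0; move: p_neq; rewrite xpair_eqE /=.
by case: eqP => _ /=; [move=> ->; rewrite mul0r | rewrite mul0rn mul0r].
Qed.

Lemma Ps_even_step (w : stvec R nt./2 nx N) i r :
  Ps tau psi psi2 w (even_step i, r) = mxC (R2 tau psi psi2)^T *m w (i, r).
Proof.
rewrite ffunE; apply/colP => k; rewrite !mxE (bigD1 (i, r))//= [X in _ + X]big1 ?addr0.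
  apply: eq_bigr => j _; rewrite Rs_unit_vec !eqxx.
  by rewrite odd_step_neq_even add0r !mxE.
move=> [i2 r2] /negPf p_neq; rewrite big1// => j _.
rewrite Rs_unit_vec (inj_eq even_step_inj) odd_step_neq_even.
rewrite mul0rn add0r; move: p_neq; rewrite xpair_eqE /=.
by case: eqP => _ /=; [move=> ->; rewrite mul0r | rewrite mul0rn mul0r].
Qed.

Lemma time_stepP (m : 'I_nt) : ~~ odd nt ->
  {i | m = odd_step i} + {i | m = even_step i}.
Proof.
move=> nt_even; have m2 : (m./2 < nt./2)%N.
  rewrite ltn_half_double; have := ltn_ord m.
  by rewrite -[X in (_ < X)%N]odd_double_half (negPf nt_even).
(* Indices are zero-based while steps are counted from one, so an odd [m] is an even step. *)
have := odd_double_half m; case: (odd m) => mE; [right | left];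
  exists (Ordinal m2); apply: val_inj; by rewrite /= -[LHS]mE.
Qed.

Lemma Ps_mode thx tht d : ~~ odd nt ->
  Ps tau psi psi2 (mode nt./2 nx thx (2 * tht) d) =
  mode nt nx thx tht (Phat tau psi psi2 tht *m d)
  + mode nt nx thx (gamma_freq tht) (Phat tau psi psi2 (gamma_freq tht) *m d).
Proof.
move=> nt_even; apply/ffunP => -[m r]; rewrite [RHS]ffunE.
rewrite [X in _ = X + _]smodeE [X in _ = _ + X]smodeE /= /Phat cis_gamma.
have [[i ->]|[i ->]] := time_stepP m nt_even.
  rewrite Ps_odd_step smodeE /= !cis_odd_step cisNgamma cis_double_gamma mulNr.
  by rewrite prolongation_symbol_odd (mulrA (cis tht)) cisK mul1r.
rewrite Ps_even_step smodeE /= !cis_even_step cis_double_gamma.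
by rewrite prolongation_symbol_even.
Qed.

End Transfer.

(** * The two-grid cycle on the space of harmonics *)

Section BlockDiagonal.
Variables (F : fieldType) (m : nat).
Implicit Types (A B : 'M[F]_m).

Lemma mul_block_diag_col A B (c d : 'cV[F]_m) :
  block_mx A 0 0 B *m col_mx c d = col_mx (A *m c) (B *m d).
Proof. by rewrite mul_block_col !mul0mx addr0 add0r. Qed.

Lemma mul_block_diagV A B (c : 'cV[F]_(m + m)) : A \in unitmx -> B \in unitmx ->
  block_mx A 0 0 B *m (block_mx (invmx A) 0 0 (invmx B) *m c) = c.
Proof.
move=> Au Bu; rewrite -(vsubmxK c); move: (usubmx c) (dsubmx c) => u d.
by rewrite !mul_block_diag_col !mulKVmx.
Qed.

Lemma mul_col_block_diag A B (c d : 'cV[F]_m) :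
  col_mx (block_mx A 0 0 A) (block_mx B 0 0 B) *m col_mx c d =
  col_mx (col_mx (A *m c) (A *m d)) (col_mx (B *m c) (B *m d)).
Proof. by rewrite mul_col_mx !mul_block_diag_col. Qed.

Lemma mul_row_block_diag A B (c1 c2 c3 c4 : 'cV[F]_m) :
  row_mx (block_mx A 0 0 A) (block_mx B 0 0 B)
    *m col_mx (col_mx c1 c2) (col_mx c3 c4) =
  col_mx (A *m c1 + B *m c3) (A *m c2 + B *m c4).
Proof. by rewrite mul_row_col !mul_block_diag_col add_col_mx. Qed.

End BlockDiagonal.

Lemma ffun_add4 (aT : finType) (V : nmodType) (f1 f2 f3 f4 : {ffun aT -> V}) p :
  (f1 + f2 + f3 + f4) p = f1 p + f2 p + f3 p + f4 p.
Proof. by rewrite !ffunE. Qed.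

Lemma sub_add4 (V : zmodType) (a1 a2 a3 a4 b1 b2 b3 b4 : V) :
  (a1 - b1) + (a2 - b2) + (a3 - b3) + (a4 - b4) =
  (a1 + a2 + a3 + a4) - (b1 + b2 + b3 + b4).
Proof. by rewrite (addrACA a1) (addrACA (a1 + a2)) (addrACA (a1 + a2 + a3)) !opprD. Qed.

Lemma linear_residual_add (F : pzRingType) (V : lmodType F) (a : F) (u v x y : V) :
  (u + v) - a *: (x + y) = (u - a *: x) + (v - a *: y).
Proof. by rewrite scalerDr opprD addrACA. Qed.

Section Harmonics.
Variables (R : realType) (nt nx N : nat) (thx tht : R).
Local Notation V := (stvec R nt nx N).
Local Notation gx := (gamma_freq thx).
Local Notation gt := (gamma_freq tht).
Local Notation mode := (mode nt nx).

(** The vector form of a harmonic, with its four blocks in the order used by [diag4]. *)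
Definition harm (c : 'cV[R[i]]_((N + N) + (N + N))) : V :=
  mode thx tht (usubmx (usubmx c)) + mode gx tht (dsubmx (usubmx c))
  + mode thx gt (usubmx (dsubmx c)) + mode gx gt (dsubmx (dsubmx c)).

Lemma harm_col c1 c2 c3 c4 :
  harm (col_mx (col_mx c1 c2) (col_mx c3 c4)) =
  mode thx tht c1 + mode gx tht c2 + mode thx gt c3 + mode gx gt c4.
Proof. by rewrite /harm !col_mxKu !col_mxKd !col_mxKu. Qed.

Lemma col4_ind (P : 'cV[R[i]]_((N + N) + (N + N)) -> Prop) :
  (forall c1 c2 c3 c4, P (col_mx (col_mx c1 c2) (col_mx c3 c4))) -> forall c, P c.
Proof.
move=> Pcol c; rewrite -(vsubmxK c); move: (usubmx c) (dsubmx c) => u d.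
by rewrite -(vsubmxK u) -(vsubmxK d).
Qed.

(** The all-ones vector multiplies from the right and the symbols from the left, so vector
    identities yield the mapping of coefficient matrices. *)
Lemma harmonic_vecE U1 U2 U3 U4 :
  harmonic_vec nt nx thx tht U1 U2 U3 U4 =
  harm (stack4 U1 U2 U3 U4 *m const_mx 1).
Proof.
rewrite /stack4 !mul_col_mx harm_col.
apply/ffunP => p; rewrite [LHS]ffunE [RHS]ffun_add4.
by congr (_ + _ + _ + _); exact: mulmx_Phi.
Qed.

Lemma harmB c d : harm (c - d) = harm c - harm d.
Proof.
elim/col4_ind: c => c1 c2 c3 c4; elim/col4_ind: d => d1 d2 d3 d4.
rewrite !opp_col_mx !add_col_mx !harm_col -sub_add4.
by congr (_ + _ + _ + _); exact: linearB.
Qed.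

Lemma harm_diag4 (F : V -> V) (f : R -> R -> 'M[R[i]]_N) c :
  {morph F : u v / u + v} ->
  (forall x t d, cis (nx%:R * x) = 1 -> cis (nt%:R * t) = 1 ->
     F (mode x t d) = mode x t (f x t *m d)) ->
  ~~ odd nx -> ~~ odd nt -> cis (nx%:R * thx) = 1 -> cis (nt%:R * tht) = 1 ->
  F (harm c) = harm (diag4 f thx tht *m c).
Proof.
move=> FD Fmode nx_even nt_even x1 t1.
have gx1 := gamma_periodic nx_even x1; have gt1 := gamma_periodic nt_even t1.
elim/col4_ind: c => c1 c2 c3 c4; rewrite /diag4 !mul_block_col !mul0mx !addr0 !add0r.
by rewrite !harm_col 3!FD !Fmode.
Qed.

End Harmonics.
Arguments harm {R} nt nx {N} thx tht c.

(** * The coarse problem on its two modes *)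

Section CoarseGrid.
Variables (R : realType) (nt nx N : nat) (tau h thx tht : R).
Variable psi : N.+1.-tuple {poly_N.+1 R}.
Local Notation V := (stvec R nt nx N.+1).
Variable Linv : V -> V.
Hypotheses (nt_gt0 : (0 < nt)%N) (nx_gt0 : (0 < nx)%N) (nx_even : ~~ odd nx).
Hypotheses (x1 : cis (nx%:R * thx) = 1) (t1 : cis (nt%:R * tht) = 1).
Hypothesis h_gt0 : 0 < h.
Hypothesis LinvP : inverse_on (Psispace nt nx N.+1 thx tht) (Lop tau h psi) Linv.

Definition coarse (d : 'cV[R[i]]_(N.+1 + N.+1)) : V :=
  mode nt nx thx tht (usubmx d) + mode nt nx (gamma_freq thx) tht (dsubmx d).

Lemma coarse_col d1 d2 : coarse (col_mx d1 d2) =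
  mode nt nx thx tht d1 + mode nt nx (gamma_freq thx) tht d2.
Proof. by rewrite /coarse col_mxKu col_mxKd. Qed.

Lemma mode0 (x t : R) : mode nt nx x t (0 : 'cV_N.+1) = 0.
Proof. exact: linear0. Qed.

Lemma coarse_in_Psi d : Psispace nt nx N.+1 thx tht (coarse d).
Proof.
(* The matrix with first column [c] and zeros elsewhere sends the all-ones vector to [c]. *)
pose U (c : 'cV[R[i]]_N.+1) := c *m delta_mx ord0 (ord0 : 'I_N.+1).
have UE c : U c *m const_mx 1 = c.
  rewrite /U -mulmxA -rowE; apply/colP => i.
  by rewrite !mxE big_ord1 !mxE mulr1.
exists (U (usubmx d)), (U (dsubmx d)); apply/ffunP => p.
rewrite [RHS]ffunE [LHS]ffunE.
by congr (_ + _); rewrite [RHS]mulmx_Phi UE.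
Qed.

Lemma Lop_coarse d : Lop tau h psi (coarse d) =
  coarse (block_mx (Lhat tau h psi thx tht) 0 0 (Lhat tau h psi (gamma_freq thx) tht) *m d).
Proof.
have gx1 := gamma_periodic nx_even x1.
rewrite -(vsubmxK d); move: (usubmx d) (dsubmx d) => d1 d2.
rewrite mul_block_diag_col !coarse_col.
by etransitivity; [exact: linearD | congr (_ + _); exact: Lop_mode].
Qed.

Lemma coarse0 : coarse 0 = 0.
Proof. by rewrite -col_mx0 coarse_col !mode0 addr0. Qed.

Lemma mode_eq0 (x t : R) (c : 'cV_N.+1) : mode nt nx x t c = 0 -> c = 0.
Proof.
move=> /ffunP/(_ (Ordinal nt_gt0, Ordinal nx_gt0)); rewrite [LHS]smodeE [RHS]ffunE => /eqP.
by rewrite !scaler_eq0 !(negPf (cis_neq0 _)) => /eqP.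
Qed.

(** [Linv] is not assumed linear; its value at 0 comes from cancelling it against the image of
    [coarse 0]. *)
Lemma Lop_coarse_inj d : Lop tau h psi (coarse d) = 0 -> coarse d = 0.
Proof.
case: LinvP => _ _ LK Ld0; have inP c := mem_set (coarse_in_Psi c).
have L0 : Lop tau h psi (coarse 0) = 0 by rewrite Lop_coarse mulmx0 coarse0.
by rewrite -(LK _ (inP d)) Ld0 -[in LHS]L0 (LK _ (inP 0)) coarse0.
Qed.

(** A kernel vector of the symbol, paired with 0 in the other mode, would be a coarse vector
    annihilated by the operator. *)
Lemma Lhat_unit : Lhat tau h psi thx tht \in unitmx.
Proof.
apply: unitmx_of_inj => c Lc0; have := @Lop_coarse_inj (col_mx c 0).
rewrite Lop_coarse mul_block_diag_col [X in col_mx X _]Lc0 mulmx0 col_mx0 coarse0.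
by move=> /(_ erefl); rewrite coarse_col mode0 addr0 => /mode_eq0.
Qed.

Lemma Lhat_gamma_unit : Lhat tau h psi (gamma_freq thx) tht \in unitmx.
Proof.
apply: unitmx_of_inj => c Lc0; have := @Lop_coarse_inj (col_mx 0 c).
rewrite Lop_coarse mul_block_diag_col [X in col_mx _ X]Lc0 mulmx0 col_mx0 coarse0.
by move=> /(_ erefl); rewrite coarse_col mode0 add0r => /mode_eq0.
Qed.

(** The right-hand side lies in the coarse space and the operator maps it to [coarse d], so left
    cancellation identifies it. *)
Lemma Linv_coarse d : Linv (coarse d) = coarse (Lstilde_inv tau h psi thx tht *m d).
Proof.
case: LinvP => _ _ LK.
rewrite -[RHS](LK _ (mem_set (coarse_in_Psi _))) Lop_coarse; congr (Linv (coarse _)).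
by rewrite /Lstilde_inv mul_block_diagV//; [exact: Lhat_unit | exact: Lhat_gamma_unit].
Qed.

End CoarseGrid.

(** * Assembling the two-grid symbol *)

Section TwoGridSymbol.
Variables (R : realType) (nt nx N : nat) (tau h omega thx tht : R).
Variables psi psi2 : N.+1.-tuple {poly_N.+1 R}.
Hypotheses (nx_gt0 : (0 < nx)%N) (nx_even : ~~ odd nx).
Hypotheses (nt_gt0 : (0 < nt)%N) (nt_even : ~~ odd nt).
Hypotheses (tau_gt0 : 0 < tau) (h_gt0 : 0 < h).
Hypothesis psi_basis : basis_of fullv psi.
Hypotheses (x1 : cis (nx%:R * thx) = 1) (t1 : cis (nt%:R * tht) = 1).
Local Notation harm := (harm nt nx thx tht).

Lemma Lop_harm c : Lop tau h psi (harm c) = harm (Ltilde tau h psi thx tht *m c).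
Proof.
apply: harm_diag4 => // [u v|x t d px pt]; first exact: linearD.
exact: Lop_mode.
Qed.

Lemma Smoother_harm nu c :
  Smoother omega tau h psi nu (harm c) = harm (Stilde omega tau h psi thx tht ^+ nu *m c).
Proof.
elim: nu => [|nu IH]; first by rewrite expr0 mul1mx.
rewrite exprS -mulmxA /Smoother iterS -/(Smoother omega tau h psi nu (harm c)) IH.
(* One smoothing sweep is additive and acts on each of the four modes by [Shat]. *)
apply: (harm_diag4 (F := fun v => v - omega%:C *: Dinv tau h psi (Lop tau h psi v))) => //.
  move=> u v; rewrite -linear_residual_add; congr (_ - _ *: _).
  rewrite /Dinv -[RHS]linearD; congr (_ _); exact: linearD.
by move=> x t d px pt; rewrite Smoother_step.
Qed.

Lemma RsD : {morph @Rs R nt nx N.+1 tau psi psi2 : u v / u + v}.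
Proof.
move=> u v; apply/ffunP => p.
rewrite [LHS]ffunE [RHS]ffunE [X in _ = X + _]ffunE [X in _ = _ + X]ffunE.
by rewrite [RHS]addrACA; congr (_ + _); rewrite ffunE; exact: mulmxDr.
Qed.

Lemma PsD : {morph @Ps R nt nx N.+1 tau psi psi2 : u v / u + v}.
Proof.
move=> u v; apply/ffunP => p; rewrite [LHS]ffunE [RHS]ffunE.
rewrite [X in _ = X + _]ffunE [X in _ = _ + X]ffunE; apply/colP => k.
rewrite [LHS]mxE [RHS]mxE [X in _ = X + _]mxE [X in _ = _ + X]mxE -big_split.
apply: eq_bigr => q _; rewrite -big_split; apply: eq_bigr => j _.
have -> : (u + v) q j ord0 = u q j ord0 + v q j ord0 by rewrite ffunE mxE.
exact: mulrDr.
Qed.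

Lemma Rs_mode_gamma x t (c : 'cV[R[i]]_N.+1) :
  Rs tau psi psi2 (mode nt nx x (gamma_freq t) c) =
  mode nt./2 nx x (2 * t) (Rhat tau psi psi2 (gamma_freq t) *m c).
Proof.
by rewrite Rs_mode; apply/ffunP => p; rewrite [LHS]smodeE [RHS]smodeE cis_double_gamma.
Qed.

Lemma Rs_harm c : Rs tau psi psi2 (harm c) =
  coarse nt./2 nx thx (2 * tht) (Rstilde tau psi psi2 tht *m c).
Proof.
elim/col4_ind: c => c1 c2 c3 c4; rewrite harm_col 3!RsD.
rewrite [X in _ + X = _]Rs_mode_gamma [X in _ + X + _ = _]Rs_mode_gamma 2!Rs_mode.
(* The four restricted modes are regrouped by spatial frequency, since the two time frequencies have
   merged. *)
rewrite /Rstilde mul_row_block_diag coarse_col -addrA [LHS]addrACA.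
by congr (_ + _); apply/esym; exact: linearD.
Qed.

Lemma Ps_coarse d : Ps tau psi psi2 (coarse nt./2 nx thx (2 * tht) d) =
  harm (Pstilde tau psi psi2 tht *m d).
Proof.
rewrite -(vsubmxK d); move: (usubmx d) (dsubmx d) => d1 d2.
rewrite /Pstilde mul_col_block_diag harm_col coarse_col PsD Ps_mode// Ps_mode//.
by rewrite [LHS]addrACA [LHS]addrA.
Qed.

Lemma two_grid_harm nu1 nu2 Linv c :
  inverse_on (Psispace nt./2 nx N.+1 thx (2 * tht)) (Lop (2 * tau) h psi2) Linv ->
  two_grid tau h psi psi2 omega nu1 nu2 Linv (harm c) =
  harm (Mstilde omega tau h psi psi2 nu1 nu2 thx tht *m c).
Proof.
move=> LinvP; have nt2_gt0 : (0 < nt./2)%N by case: nt nt_gt0 nt_even => [|[]].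
(* The doubled frequency is periodic over half as many steps because [nt] is even. *)
have t2 : cis (nt./2%:R * (2 * tht)) = 1.
  rewrite mulrA -natrM muln2; have := odd_double_half nt.
  by rewrite (negPf nt_even) add0n => ->.
rewrite /two_grid Smoother_harm Lop_harm Rs_harm.
rewrite (Linv_coarse nt2_gt0 nx_gt0 nx_even x1 t2 h_gt0 LinvP) Ps_coarse -harmB.
rewrite Smoother_harm; congr harm; rewrite /Mstilde /Kstilde -!mulmxA; congr (_ *m _).
by rewrite mulmxBl mul1mx !mulmxA.
Qed.

End TwoGridSymbol.

Theorem theorem3p23 (R : realType) (pt NLx NLt nu1 nu2 : nat) (tauL hL omega : R)
  (psi psi2 : (pt.+1).-tuple {poly_(pt.+1) R})
  (Lcinv : stvec R NLt./2 NLx pt.+1 -> stvec R NLt./2 NLx pt.+1)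
  (thx tht : R)
  (NLx_gt0 : (0 < NLx)%N) (NLx_even : ~~ odd NLx)
  (NLt_gt0 : (0 < NLt)%N) (NLt_even : ~~ odd NLt)
  (nu1_gt0 : (0 < nu1)%N) (nu2_gt0 : (0 < nu2)%N)
  (tauL_gt0 : 0 < tauL) (hL_gt0 : 0 < hL)
  (psi_basis : basis_of fullv psi) (psi2_basis : basis_of fullv psi2)
  (th_low : Theta_lowf NLx NLt (thx, tht))
  (Lcinv_inverse : inverse_on (Psispace NLt./2 NLx pt.+1 thx (2 * tht))
                     (Lop (2 * tauL) hL psi2) Lcinv) :
  let Ms : stvec R NLt NLx pt.+1 -> stvec R NLt NLx pt.+1 :=
    two_grid tauL hL psi psi2 omega nu1 nu2 Lcinv in
  set_fun (Espace NLt NLx pt.+1 thx tht) (Espace NLt NLx pt.+1 thx tht) Ms /\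
  (forall U1 U2 U3 U4 V1 V2 V3 V4 : 'M[R[i]]_(pt.+1),
     stack4 V1 V2 V3 V4 =
       Mstilde omega tauL hL psi psi2 nu1 nu2 thx tht *m stack4 U1 U2 U3 U4 ->
     Ms (harmonic_vec NLt NLx thx tht U1 U2 U3 U4) =
       harmonic_vec NLt NLx thx tht V1 V2 V3 V4).
Proof.
move=> Ms; have [[/= fx ft] _] := th_low.
have x1 := freqs_periodic NLx_gt0 fx; have t1 := freqs_periodic NLt_gt0 ft.
have symbol U1 U2 U3 U4 V1 V2 V3 V4 :
    stack4 V1 V2 V3 V4 =
      Mstilde omega tauL hL psi psi2 nu1 nu2 thx tht *m stack4 U1 U2 U3 U4 ->
    Ms (harmonic_vec NLt NLx thx tht U1 U2 U3 U4) =
      harmonic_vec NLt NLx thx tht V1 V2 V3 V4.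
  move=> VE; rewrite !harmonic_vecE VE -mulmxA; exact: two_grid_harm.
split=> // _ [U1 [U2 [U3 [U4 ->]]]].
set W := Mstilde omega tauL hL psi psi2 nu1 nu2 thx tht *m stack4 U1 U2 U3 U4.
(* The new coefficient matrices are the four blocks of the iteration matrix applied to the old
   stack. *)
exists (usubmx (usubmx W)), (dsubmx (usubmx W)), (usubmx (dsubmx W)), (dsubmx (dsubmx W)).
by apply: symbol; rewrite /stack4 !vsubmxK.
Qed.
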